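(* Let $(L,\le)$ be a dual algebraic coframe such that $\mathcal{K}(L,\le)$ has a choice function. For every $x\in L$, $$x=\mathtt{c}(x)\vee\left(\bigvee_{n\in\mathcal{M}(x)}(x-n)\right).$$
   Context: A filtered set is a nonempty poset in which any two elements have a common lower bound. An element $x$ of a poset $(L,\le)$ is dually compact if for every filtered $F\subset L$ having an infimum with $\bigwedge F\le x$ there is $f\in F$ with $f\le x$; $\mathcal{K}(L,\le)$ is the set of dually compact elements. A dual algebraic lattice is a lattice in which every subset has an infimum and every $x$ equals $\bigwedge F_x$ for some filtered $F_x\subset\mathcal{K}(L,\le)$. A coframe is a lattice in which every subset has an infimum and $x\vee\bigwedge_{s\in S}s=\bigwedge_{s\in S}(x\vee s)$ for all $x\in L$, $S\subset L$. A dual algebraic coframe is both. A choice function of a set $S$ is a map $\theta:\mathcal{P}(S)\setminus\{\emptyset\}\to S$ with $\theta(P)\in P$ for all $P$. $\mathcal{M}(x)$ is the set of maximal elements of $\{z\in L: z<x\}$; $\mu(x):=\bigwedge\mathcal{M}(x)$ if $\mathcal{M}(x)\ne\emptyset$, and $\mu(x):=x$ otherwise. Define $x^{(0)}:=x$, $x^{(\alpha+1)}:=\mu(x^{(\alpha)})$, and $x^{(\lambda)}:=\bigwedge_{\alpha<\lambda}x^{(\alpha)}$ for limit $\lambda$. $\mathtt{r}(x)$ is the least ordinal $\alpha$ with $x^{(\alpha)}=x^{(\alpha+1)}$, and $\mathtt{c}(x):=x^{(\mathtt{r}(x))}$ is the core of $x$. For $y\le x$, $x-y:=\bigwedge\{w\in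 L: w\le x,\ y\vee w=x\}$. The join of the empty set is the minimum of $L$. *)

(* Defs.v *)
From HB Require Import structures.
From mathcomp Require Import all_boot all_order.
From mathcomp Require Import boolp classical_sets wochoice.

Set Implicit Arguments.
Unset Strict Implicit.
Unset Printing Implicit Defensive.

Import Order.TTheory.

Local Open Scope order_scope.
Local Open Scope classical_set_scope.

Section Posets.
Context {d : Order.disp_t} {P : porderType d}.
Implicit Types (x : P) (F : set P).

Definition filtered F : Prop :=
  F !=set0 /\
  forall a b, F a -> F b -> exists c, [/\ F c, c <= a & c <= b].

Definition dually_compact : set P := [set x |
  forall F m, filtered F -> infimums F m -> m <= x ->
    exists2 f, F f & f <= x].

End Posets.

Arguments dually_compact {d} P.

Definition has_choice_function {T : Type} (S : set T) : Prop :=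
  exists theta : {P : set T | P `<=` S /\ P !=set0} -> T,
    forall P, sval P (theta P).

HB.mixin Record hasBigmeet d L of Order.Lattice d L := {
  bigmeet : set L -> L;
  bigmeetP : forall S : set L, infimums S (bigmeet S)
}.

#[short(type="completeLatticeType")]
HB.structure Definition CompleteLattice d :=
  { L of Order.Lattice d L & hasBigmeet d L }.

Section CompleteLattices.
Context {d : Order.disp_t} {L : completeLatticeType d}.
Implicit Types (x y : L) (S : set L).

Definition bigjoin S : L := bigmeet (ubound S).

Lemma bigjoinP S : supremums S (bigjoin S).
Proof.
have [lbS ubS] := bigmeetP (ubound S); split=> // x Sx.
by apply: ubS => y; apply.
Qed.

(* In particular [bigjoin set0] is the minimum of [L]. *)
Lemma bigjoin0_le x : bigjoin set0 <= x.
Proof. by have [_] := bigjoinP set0; apply=> y []. Qed.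

Lemma bigmeet_le S x : S x -> bigmeet S <= x.
Proof. by move=> Sx; have [+ _] := bigmeetP S; apply. Qed.

(* The difference [x - y], meant for [y <= x]. *)
Definition lowersub x y : L := bigmeet [set w | w <= x /\ (y `|` w)%O = x].

Definition lower_covers x : set L :=
  [set z | z < x /\ forall w, w < x -> z <= w -> w = z].

Definition mu x : L :=
  if pselect (lower_covers x !=set0) then bigmeet (lower_covers x) else x.

Lemma mu_le x : mu x <= x.
Proof.
rewrite /mu; case: pselect => // -[z zx].
by apply: (le_trans (bigmeet_le zx)); case: zx => /ltW.
Qed.

End CompleteLattices.

Definition coframe {d} (L : completeLatticeType d) : Prop :=
  forall (x : L) (S : set L),
    (x `|` bigmeet S)%O = bigmeet [set (x `|` s)%O | s in S].

Definition dual_algebraic {d} (L : completeLatticeType d) : Prop :=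
  forall x : L, exists F : set L,
    [/\ filtered F, F `<=` dually_compact L & x = bigmeet F].

(* Ordinals are represented by well-ordered types; isomorphic representatives
   are not identified, but the constructions below are invariant under
   isomorphism. *)
Record ord := Ord {
  osort :> Type;
  olt : osort -> osort -> Prop;
  olt_wf : well_founded olt;
  olt_trans : forall b a c, olt a b -> olt b c -> olt a c;
  olt_total : forall a b, [\/ olt a b, a = b | olt b a] }.

Lemma sval_inj (T : Type) (P : T -> Prop) : injective (@proj1_sig T P).
Proof. by move=> [s p] [t q] /= st; exact: eq_exist. Qed.

Section OrdinalConstructions.
Variable A : ord.

Lemma olt_irr (a : A) : ~ olt a a.
Proof. by elim/(well_founded_ind (@olt_wf A)): a => a IH aa; exact: (IH a). Qed.

Section Segment.
Variable a : A.

Let seg := {b : A | olt b a}.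
Let segr (b c : seg) := olt (sval b) (sval c).

Let segr_wf : well_founded segr.
Proof.
move=> [b ba]; move: b ba.
elim/(well_founded_ind (@olt_wf A)) => b IH ba.
by constructor=> -[c ca] cb; exact: IH.
Qed.

Let segr_trans (b c e : seg) : segr c b -> segr b e -> segr c e.
Proof. exact: olt_trans. Qed.

Let segr_total (b c : seg) : [\/ segr b c, b = c | segr c b].
Proof.
case: (olt_total (sval b) (sval c)) => [bc|bc|cb].
- exact: Or31.
- by apply: Or32; exact: sval_inj.
- exact: Or33.
Qed.

(* The ordinals smaller than [A] are, up to isomorphism, the [oseg a]. *)
Definition oseg : ord := Ord segr_wf segr_trans segr_total.

End Segment.

Let succr (u v : option A) : Prop :=
  match u, v with
  | Some b, Some c => olt b c
  | Some _, None => True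
  | None, _ => False
  end.

Let succr_wf : well_founded succr.
Proof.
have wfS b : Acc succr (Some b).
  elim/(well_founded_ind (@olt_wf A)): b => b IH.
  by constructor=> -[c|//] cb; exact: IH.
by move=> [b|]; [exact: wfS | constructor=> -[b _|//]; exact: wfS].
Qed.

Let succr_trans v u w : succr u v -> succr v w -> succr u w.
Proof. by case: u v w => [u|] [v|] [w|] //=; exact: olt_trans. Qed.

Let succr_total u v : [\/ succr u v, u = v | succr v u].
Proof.
case: u v => [u|] [v|] /=; [|by apply: Or31|by apply: Or33|by apply: Or32].
by case: (olt_total u v) => [||] h; [exact: Or31|apply: Or32; rewrite h|exact: Or33].
Qed.

Definition osucc : ord := Ord succr_wf succr_trans succr_total.

End OrdinalConstructions.

Section Derivatives.
Context {d : Order.disp_t} {L : completeLatticeType d}.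
Implicit Types (x : L) (A B : ord).

Definition is_greatest (S : Type) (lt : S -> S -> Prop) (p : S) : Prop :=
  forall q, q = p \/ lt q p.

(* [S] is the set of all ordinals smaller than some [alpha], and [f] gives the
   iterates of [x] at these ordinals; the result is the iterate of [x] at
   [alpha], with [alpha] a successor, zero, or a limit respectively. *)
Definition stage x (S : Type) (lt : S -> S -> Prop) (f : S -> L) : L :=
  match pselect (exists p, is_greatest lt p) with
  | left h => mu (f (sval (cid h)))
  | right _ => if pselect (inhabited S) then bigmeet (range f) else x
  end.

Definition iterates x A : A -> L :=
  Fix (@olt_wf A) (fun=> L)
    (fun a rec => stage x (@olt (oseg a)) (fun b => rec (sval b) (svalP b))).

Definition iterate x A : L := stage x (@olt A) (@iterates x A).

Lemma iteratesE x A (a : A) :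
  iterates x a = stage x (@olt (oseg a)) (fun b => iterates x (sval b)).
Proof.
rewrite /iterates Fix_eq// => b f g fg; congr stage.
by apply/funext => c; exact: fg.
Qed.

Lemma stage_iso x (S T : Type) (ltS : S -> S -> Prop) (ltT : T -> T -> Prop)
    (h : S -> T) (f : S -> L) (g : T -> L) :
  (forall t, exists s, h s = t) ->
  (forall s s', h s = h s' -> s = s') ->
  (forall s s', ltS s s' <-> ltT (h s) (h s')) ->
  (forall t, ~ ltT t t) -> (forall t u v, ltT t u -> ltT u v -> ltT t v) ->
  (forall s, f s = g (h s)) ->
  stage x ltS f = stage x ltT g.
Proof.
move=> hs hi hm irr tr fg; rewrite /stage.
have topP p : is_greatest ltS p <-> is_greatest ltT (h p).
  split=> [pt q|pt q].
    have [s <-] := hs q; case: (pt s) => [->|/hm]; by [left|right].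
  by case: (pt (h q)) => [/hi|/hm]; [left|right].
case: (pselect (exists p, is_greatest ltS p)) => [e1|n1];
  case: (pselect (exists p, is_greatest ltT p)) => [e2|n2].
- case: (cid e1) => p /= /topP p1; case: (cid e2) => q /= q1.
  rewrite fg; congr (mu (g _)).
  case: (p1 q) => [//|qp]; case: (q1 (h p)) => [//|pq].
  by case: (irr q); exact: tr pq.
- by case: n2; case: e1 => p /topP; exists (h p).
- by case: n1; case: e2 => q; have [p <-] := hs q; move=> /topP; exists p.
- case: pselect => [[s]|nS]; case: pselect => [iT|nT].
  + congr bigmeet; apply/seteqP; split=> _ [u _ <-].
      by rewrite fg; exists (h u).
    by have [s' <-] := hs u; rewrite -fg; exists s'.
  + by case: nT; exists; exact: h s.
  + by case: nS; case: iT => t; have [s' _] := hs t; exists.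
  + by [].
Qed.

Lemma iterates_embed x A B (e : A -> B) :
  (forall a b, olt a b <-> olt (e a) (e b)) ->
  (forall a b, olt b (e a) -> exists a', e a' = b) ->
  forall a, iterates x a = iterates x (e a).
Proof.
move=> em ed a; elim/(well_founded_ind (@olt_wf A)): a => a IH.
rewrite !iteratesE.
pose h (b : oseg a) : oseg (e a) :=
  exist _ (e (sval b)) ((em _ _).1 (svalP b)).
apply: (@stage_iso _ _ _ _ _ h).
- move=> [t ta]; have [s st] := ed _ _ ta.
  have sa : olt s a by apply/em; rewrite st.
  by exists (exist _ s sa); exact: sval_inj.
- move=> [s sa] [t ta] [] est; apply: sval_inj => /=.
  case: (olt_total s t) => [/em|//|/em]; rewrite est => /olt_irr [].
- by move=> s t; exact: em.
- by move=> t; exact: olt_irr.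
- by move=> t u v; exact: olt_trans.
- by move=> [s sa] /=; exact: IH.
Qed.

Lemma iterate_seg x A (a : A) : iterate x (oseg a) = iterates x a.
Proof.
rewrite /iterate iteratesE; congr stage; apply/funext => b.
apply: (@iterates_embed _ (oseg a) A (fun b => sval b)) => //.
by move=> [c ca] e ec; exists (exist _ e (olt_trans ec ca)).
Qed.

Lemma iterate_zero x A : ~ inhabited A -> iterate x A = x.
Proof.
move=> A0; rewrite /iterate /stage; case: pselect => [[p]|_].
  by case: A0; exists.
by case: pselect.
Qed.

Lemma iterate_succ x A : iterate x (osucc A) = mu (iterate x A).
Proof.
rewrite {1}/iterate /stage; case: pselect => [h|[]]; last first.
  by exists None => -[a|]; [right|left].
case: (cid h) => -[p|] /= pt; first by case: (pt None).
congr mu; rewrite iteratesE; symmetry.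
have si a : @iterates x A a = @iterates x (osucc A) (Some a).
  by apply: (@iterates_embed _ A (osucc A) Some) => // b [c|//] _; exists c.
pose k (a : A) : @oseg (osucc A) None :=
  exist (fun b : osucc A => @olt (osucc A) b None) (Some a) I.
apply: (@stage_iso _ _ _ _ _ k) => //.
- by move=> [[a|//] []]; exists a.
- by move=> s s' [].
- by move=> t; exact: olt_irr.
- by move=> t u v; exact: olt_trans.
Qed.

Lemma iterate_limit x A :
  inhabited A -> ~ (exists p : A, is_greatest (@olt A) p) ->
  iterate x A = bigmeet [set iterate x (oseg a) | a in [set: A]].
Proof.
move=> iA nA; rewrite {1}/iterate /stage; case: pselect => //= _.
case: pselect => //= _; congr bigmeet; apply: eq_imagel => a _.
exact/esym/iterate_seg.
Qed.

(* [A] is the least ordinal at which the iterates of [x] are stationary. *)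
Definition is_rank x A : Prop :=
  iterate x A = iterate x (osucc A) /\
  forall a : A, iterate x (oseg a) <> iterate x (osucc (oseg a)).

Lemma iterates_lt x A (a b : A) :
  olt a b -> iterates x b <= mu (iterates x a).
Proof.
elim/(well_founded_ind (@olt_wf A)): b => b IH ab.
rewrite iteratesE /stage; case: pselect => [h|np].
  case: (cid h) => -[p pb] /= pt; case: (pt (exist _ a ab)) => [[->//]|ap].
  exact: le_trans (mu_le _) (IH _ pb ap).
case: pselect => [iS /=|[]]; last by exists; exists a.
have [[c cb] ac] : exists c : oseg b, olt a (sval c).
  apply: contrapT => nc; apply: np; exists (exist _ a ab) => -[c cb].
  case: (olt_total c a) => [ca|ca|ac]; first by right.
    by left; exact: sval_inj.
  by case: nc; exists (exist _ c cb).
by apply: le_trans (IH c cb ac); apply: bigmeet_le; exists (exist _ c cb).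
Qed.

End Derivatives.

Lemma exists_ord (T : Type) : exists A : ord, T = osort A.
Proof.
have [R Rwo] := well_ordering_principle {classic T}.
have Rtot (a b : T) : R a b \/ R b a.
  have [|z [[zab zmin] _]] := Rwo [pred u | `[< u = a \/ u = b >]].
    by exists a; apply/asboolP; left.
  have Ra : R z a by apply: zmin; apply/asboolP; left.
  have Rb : R z b by apply: zmin; apply/asboolP; right.
  by move/asboolP: zab => [za|zb]; [left; rewrite -za|right; rewrite -zb].
have Ranti (a b : T) : R a b -> R b a -> a = b.
  have Rxx c : R c c by case: (Rtot c c).
  move=> ab ba; have [|z [_ zu]] := Rwo [pred u | `[< u = a \/ u = b >]].
    by exists a; apply/asboolP; left.
  rewrite -(zu a) ?(zu b)//; split; try (by apply/asboolP; auto);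
    by move=> u /asboolP[|] ->.
pose lt (a b : T) : Prop := ~~ R b a.
have lt_wf : well_founded lt.
  move=> a; apply: contrapT => na.
  have [|z [[/asboolP nz zmin] _]] := Rwo [pred u | `[< ~ Acc lt u >]].
    by exists a; apply/asboolP.
  apply: nz; constructor=> u uz; apply: contrapT => nu.
  by move: uz; rewrite /lt zmin//; apply/asboolP.
have lt_total a b : [\/ lt a b, a = b | lt b a].
  case: (boolP (R a b)) => ab; last exact: Or33.
  case: (boolP (R b a)) => ba; last exact: Or31.
  by apply: Or32; exact: Ranti.
have lt_irr a : ~ lt a a by rewrite /lt; case: (Rtot a a) => ->.
have lt_trans b a c : lt a b -> lt b c -> lt a c.
  move=> ab bc; case: (lt_total a c) => // [ac|ca].
    by move: ab bc; rewrite -ac /lt; case: (Rtot a b) => ->.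
  have [|z [[/asboolP zin zmin] _]] :=
      Rwo [pred u | `[< [\/ u = a, u = b | u = c] >]].
    by exists a; apply/asboolP; exact: Or31.
  have zle u : [\/ u = a, u = b | u = c] -> ~ lt u z.
    by move=> uin; rewrite /lt zmin//; apply/asboolP.
  case: zin => ez; subst z; exfalso.
  - by apply: (zle c) => //; exact: Or33.
  - by apply: (zle a) => //; exact: Or31.
  - by apply: (zle b) => //; exact: Or32.
by exists (Ord lt_wf lt_trans lt_total).
Qed.

Section Core.
Context {d : Order.disp_t} {L : completeLatticeType d}.
Implicit Type x : L.

Lemma exists_rank x : exists A, is_rank x A.
Proof.
have [A eA] := exists_ord (set L).
have [a fa] : exists a : A, iterates x a = mu (iterates x a).
  apply: contrapT => nfix.
  have finj (a b : A) : iterates x a = iterates x b -> a = b.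
    have lt_neq (u v : A) : olt u v -> iterates x u <> iterates x v.
      move=> uv e; apply: nfix; exists u; apply/eqP.
      by rewrite eq_le mu_le andbT {1}e iterates_lt.
    move=> e; case: (olt_total a b) => [/lt_neq|//|/lt_neq]; first by [].
    by move/(_ (esym e)).
  have [g ginj] : exists g : set L -> L, injective g.
    by move: (@iterates _ _ x A) finj; rewrite -eA => g ginj; exists g.
  pose D : set L := [set y | exists2 S, g S = y & ~ S y].
  case: (pselect (D (g D))) => [DD|nDD]; last by apply: (nDD); exists D.
  by have [S /ginj SD nS] := DD; apply: nS; rewrite SD.
have {fa} [b [fb bmin]] : exists b : A, iterates x b = mu (iterates x b) /\
    forall c, olt c b -> iterates x c <> mu (iterates x c).
  elim/(well_founded_ind (@olt_wf A)): a fa => a IH fa.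
  have [[c ca fc]|nc] := pselect
      (exists2 c, olt c a & iterates x c = mu (iterates x c)).
    exact: IH c ca fc.
  by exists a; split=> // c ca fc; apply: nc; exists c.
exists (oseg b); split; first by rewrite iterate_succ iterate_seg.
move=> [c cb]; rewrite iterate_succ iterate_seg.
rewrite (_ : iterates x _ = iterates x c); first exact: bmin.
apply: (@iterates_embed _ _ x (oseg b) A (fun u => sval u)) => //.
by move=> [u ub] v vu; exists (exist _ v (olt_trans vu ub)).
Qed.

Definition rank x : ord := sval (cid (exists_rank x)).

Definition core x : L := iterate x (rank x).

End Core.

(* Main.v *)
Require Import Defs.
From HB Require Import structures.
From mathcomp Require Import all_boot all_order.
From mathcomp Require Import boolp classical_sets.

(** Call [z] _the right-hand side_ of the identity; [z <= x] is clear.  The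
    idea is to watch [z `|` x^(alpha)] as [alpha] grows.  It equals [x] at
    [alpha = 0], and it never drops below [x] afterwards:

    - at a limit, because joining with [z] commutes with meets in a coframe;
    - at a successor, because for a lower cover [m] of [y = x^(alpha)] with
      [z `|` y = x], the element [z `|` m] is either [x] or a lower cover of
      [x] ([joinx_lower_cover]); it cannot be a lower cover [n], since such an
      [n] would lie above [z], hence above [x - n], and [n `|` (x - n) = x]
      ([join_lowersub]).

    So [z] joined with any iterate of [x] is [x] ([join_iterate]).  As the
    core is one of the iterates and lies below [z], this gives [z = x]. *)

Set Implicit Arguments.
Unset Strict Implicit.
Unset Printing Implicit Defensive.

Import Order.TTheory.

Local Open Scope classical_set_scope.
Local Open Scope order_scope.

Section CompleteLattices.
Context {d : Order.disp_t} {L : completeLatticeType d}.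
Implicit Types (x y z : L) (S : set L).

Lemma le_bigmeet S y : (forall s, S s -> y <= s) -> y <= bigmeet S.
Proof. by move=> yS; have [_ +] := bigmeetP S; apply. Qed.

Lemma bigjoin_le S y : (forall s, S s -> s <= y) -> bigjoin S <= y.
Proof. by move=> Sy; have [_ +] := bigjoinP S; apply. Qed.

Lemma le_bigjoin S y : S y -> y <= bigjoin S.
Proof. by move=> Sy; have [+ _] := bigjoinP S; apply. Qed.

Lemma bigmeet2 x y : bigmeet [set x; y] = x `&` y.
Proof.
apply/le_anti/andP; split.
  by rewrite lexI !bigmeet_le//; [right|left].
by apply: le_bigmeet => s [|] ->; rewrite ?leIl ?leIr.
Qed.

Lemma lowersub_le x n : n <= x -> lowersub x n <= x.
Proof. by move=> nx; apply: bigmeet_le; split=> //; exact: join_r. Qed.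

End CompleteLattices.

Section Coframes.
Context {d : Order.disp_t} {L : completeLatticeType d}.
Context (L_coframe : coframe L).
Implicit Types (x y z m n u : L) (S : set L).

Lemma coframe_joinIr z x y : z `|` (x `&` y) = (z `|` x) `&` (z `|` y).
Proof.
by rewrite -bigmeet2 L_coframe image_setU !image_set1 bigmeet2.
Qed.

Lemma join_bigmeet_const z x S :
  S !=set0 -> (forall s, S s -> z `|` s = x) -> z `|` bigmeet S = x.
Proof.
move=> [s Ss] Sx; rewrite L_coframe; apply/le_anti/andP; split.
  by apply: bigmeet_le; exists s => //; exact: Sx.
by apply: le_bigmeet => _ [t St <-]; rewrite Sx.
Qed.

(** The set whose meet is [x - n] is cut out by an equation that a coframe
    preserves under meets, so [x - n] is its least solution. *)
Lemma join_lowersub x n : n <= x -> n `|` lowersub x n = x.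
Proof.
move=> nx; apply: join_bigmeet_const => [|w []//].
by exists x; split=> //; exact: join_r.
Qed.

(** An element [u] between [z `|` m] and [x = z `|` y] is recovered from its
    trace [u `&` y] as [z `|` (u `&` y)]; the trace lies between [m] and [y],
    which leaves only two possibilities. *)
Lemma joinx_lower_cover x y z m :
  z `|` y = x -> lower_covers y m -> z `|` m <> x ->
  lower_covers x (z `|` m).
Proof.
move=> zyx [my mmax] zmx; split=> [|u ux zmu].
  by rewrite lt_neqAle; apply/andP; split; [exact/eqP|rewrite -zyx leU2// ltW].
have [zu mu_] : z <= u /\ m <= u by apply/andP; rewrite -leUx.
have uE : z `|` (u `&` y) = u.
  rewrite coframe_joinIr zyx.
  by rewrite (join_r zu); exact/meet_idPl/ltW.
have uyy : u `&` y < y.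
  rewrite lt_neqAle leIr andbT; apply/eqP => uy.
  by move: ux; rewrite -uE uy zyx ltxx.
by rewrite -uE (mmax _ uyy)// lexI mu_ ltW.
Qed.

Section AboveDifferences.
Context (x z : L) (zx : z <= x).
Context (z_lowersub : forall n, lower_covers x n -> lowersub x n <= z).

Lemma not_le_lower_cover n : lower_covers x n -> ~ z <= n.
Proof.
move=> xn zn; have [nx _] := xn.
have := join_lowersub (ltW nx).
rewrite (join_l (le_trans (z_lowersub xn) zn)) => nE.
by move: nx; rewrite nE ltxx.
Qed.

Lemma join_mu y : z `|` y = x -> z `|` mu y = x.
Proof.
move=> zyx; rewrite /mu; case: pselect => // M0.
apply: join_bigmeet_const => // m ym; apply: contrapT => zmx.
by apply: (not_le_lower_cover (joinx_lower_cover zyx ym zmx)); exact: leUl.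
Qed.

Lemma join_stage (S : Type) (lt : S -> S -> Prop) (f : S -> L) :
  (forall s, z `|` f s = x) -> z `|` stage x lt f = x.
Proof.
move=> zf; rewrite /stage; case: pselect => [h|_]; first exact: join_mu.
case: pselect => /= [[s]|_]; last exact: join_r.
by apply: join_bigmeet_const => [|_ [t _ <-]//]; exists (f s), s.
Qed.

Lemma join_iterate (A : ord) : z `|` iterate x A = x.
Proof.
apply: join_stage => a.
elim/(well_founded_ind (@olt_wf A)): a => a IH.
rewrite iteratesE; apply: join_stage => b; exact: (IH _ (svalP b)).
Qed.

End AboveDifferences.

End Coframes.

Lemma iterate_le (d : Order.disp_t) (L : completeLatticeType d)
    (x : L) (A : ord) :
  coframe L -> iterate x A <= x.
Proof.
(* The extreme case [z = x] of the invariant. *)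
move=> L_coframe; apply/join_idPl/join_iterate => // n [/ltW nx _].
exact: lowersub_le.
Qed.

Local Close Scope order_scope.

Theorem proposition4p9 (d : Order.disp_t) (L : completeLatticeType d)
    (L_coframe : coframe L) (L_dual_algebraic : dual_algebraic L)
    (K_choice : has_choice_function (dually_compact L)) (x : L) :
  x = (core x `|` bigjoin [set lowersub x n | n in lower_covers x])%O.
Proof.
set D := bigjoin _; set z := (core x `|` D)%O.
have zx : (z <= x)%O.
  rewrite leUx iterate_le//=; apply: bigjoin_le => _ [n [/ltW nx _] <-].
  exact: lowersub_le.
have z_lowersub n : lower_covers x n -> (lowersub x n <= z)%O.
  move=> xn; apply: le_trans (leUr _ _).
  by apply: le_bigjoin; exists n.
rewrite -[LHS](join_iterate L_coframe zx z_lowersub (rank x)).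
by apply: join_l; exact: leUl.
Qed.
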